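(* Let $\Lambda=(V,E)$ be a region of $\mathbb L^d$, let $\lambda\in\Theta$, and let $a\in(0,1)$, $p\in[0,1)$. If $q\in[1,2]$, then the probability measure $\Phi^\lambda_{\Lambda,a,p,q}$ on $\{0,1\}^V$ is strongly positively associated, and hence monotonic.
   Context: Let $d\ge2$ and let $\mathbb L^d=(\mathbb Z^d,\mathbb E^d)$ be the hypercubic lattice, where $\mathbb E^d$ is the set of unordered pairs $\langle x,y\rangle$ with $\sum_i|x_i-y_i|=1$. A region is a pair $\Lambda=(V,E)$ where $V\subset\mathbb Z^d$ is finite and $E$ is the set of all edges of $\mathbb E^d$ with at least one endvertex in $V$. Let $\Lambda^+=(V^+,E)$ be the subgraph of $\mathbb L^d$ induced by the edge-set $E$ (so $V^+$ consists of the endvertices of edges in $E$). Let $\Psi=\{0,1\}^{\mathbb Z^d}$, $\Omega=\{0,1\}^{\mathbb E^d}$. For $\psi\in\Psi$, $\omega\in\Omega$ let $\mathbb Z^d_\psi=\{x:\psi_x=1\}$, $\mathbb E^d_\psi=\{\langle x,y\rangle\in\mathbb E^d:\psi_x=\psi_y=1\}$ and $\eta(\omega)=\{e:\omega_e=1\}$. Let $\Theta$ be the set of $(\psi,\omega)\in\Psi\times\Omega$ with $\eta(\omega)\subseteq\mathbb E^d_\psi$. For $\lambda=(\kappa,\rho)\in\Theta$ let $\Theta^\lambda_\Lambda$ be the set of $(\psi,\omega)\in\Theta$ with $\psi_x=\kappa_x$ for $x\notin V$ and $\omega_e=\rho_e$ for $e\notin E$. With $r=\sqrt{1-p}$, the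 diluted-random-cluster measure on $\Lambda$ with boundary condition $\lambda$ is $$\phi^\lambda_{\Lambda,a,p,q}(\theta)=\frac1Z\,r^{|E_\psi|}q^{k(\theta,\Lambda)}\prod_{x\in V}\Big(\frac a{1-a}\Big)^{\psi_x}\prod_{e\in E_\psi}\Big(\frac p{1-p}\Big)^{\omega_e},\qquad\theta=(\psi,\omega)\in\Theta^\lambda_\Lambda,$$ and $0$ otherwise, where $E_\psi=\{\langle x,y\rangle\in E:\psi_x=\psi_y=1\}$, $k(\theta,\Lambda)$ is the number of connected components of $(\mathbb Z^d_\psi,\eta(\omega))$ that intersect $V^+$, and $Z$ is the normalizing constant. It is effectively supported on $\{0,1\}^V\times\{0,1\}^E$, and $\Phi^\lambda_{\Lambda,a,p,q}$ denotes its marginal on $\{0,1\}^V$. Let $I$ be finite, $\Sigma=\{0,1\}^I$ with the coordinatewise partial order. A probability measure $\mu$ on $\Sigma$ is positively associated if $\mu(A\cap B)\ge\mu(A)\mu(B)$ for all increasing events $A,B\subseteq\Sigma$. For $\tau\in\Sigma$, $J\subseteq I$ let $\Sigma^\tau_J=\{\sigma\in\Sigma:\sigma_i=\tau_i\text{ for }i\notin J\}$. The measure $\mu$ is strongly positively associated if, for all $\tau,J$, the conditional measure given $\Sigma_J^\tau$ is positively associated when viewed as a measure on $\{0,1\}^J$. It is monotonic if, for all $i\in I$, $\mu(\sigma_i=1\mid\Sigma^\tau_{\{i\}})$ is a non-decreasing function of $\tau$. *)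

(* Defs.v *)
From Stdlib Require Import Relation_Operators.
From HB Require Import structures.
From mathcomp Require Import all_boot all_order all_algebra finmap.
From mathcomp Require Import all_classical reals.

Set Implicit Arguments.
Unset Strict Implicit.
Unset Printing Implicit Defensive.

Import Order.TTheory GRing.Theory Num.Theory.
Local Open Scope classical_set_scope.
Local Open Scope ring_scope.

Definition vertex (d : nat) := {ffun 'I_d -> int}.

Definition adjacent (d : nat) (x y : vertex d) : bool :=
  \sum_(i < d) `|x i - y i| == 1.

(* An unordered pair <x, y> is the two-element set {x, y}. *)
Definition is_edge (d : nat) (e : {fset vertex d}) : bool :=
  [exists x : e, exists y : e,
     (e == [fset val x; val y]%fset) && adjacent (val x) (val y)].

Definition edge (d : nat) := {e : {fset vertex d} | is_edge e}.

Record region (d : nat) := Region {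
  rV : {fset vertex d};
  rE : {fset edge d};
  rEP : forall e : edge d, (e \in rE) = [exists x : rV, val x \in val e] }.

Lemma region_exists (d : nat) (V : {fset vertex d}) :
  exists L : region d, rV L = V.
Proof.
pose box (x : vertex d) (c : {ffun 'I_d -> 'I_3}) : vertex d :=
  [ffun i => x i + ((c i)%:Z - 1)].
pose s : seq {fset vertex d} :=
  [seq [fset x; box x c]%fset | x <- enum_fset V, c <- enum {ffun 'I_d -> 'I_3}].
pose E : {fset edge d} :=
  [fset e : edge d in pmap insub s | [exists x : V, val x \in val e]]%fset.
suff HE (e : edge d) : (e \in E) = [exists x : V, val x \in val e].
  by exists (Region HE).
rewrite !inE /= andb_idl // => /existsP[x xe].
rewrite (mem_pmap_sub s); case: e xe => e /= ee xe.
have boxP (y : vertex d) : adjacent (val x) y -> exists c, y = box (val x) c.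
  move=> /eqP xy.
  have le1 i : `|val x i - y i| <= 1.
    by rewrite -xy (bigD1 i) //= lerDl sumr_ge0.
  exists [ffun i => inord (absz (y i - val x i + 1))].
  apply/ffunP => i; rewrite !ffunE.
  have := le1 i; rewrite distrC ler_norml => /andP[h1 h2].
  have h3 : 0 <= y i - val x i + 1 by rewrite -lerBlDr sub0r.
  rewrite inordK; first by rewrite gez0_abs // addrK addrC subrK.
  by rewrite -ltz_nat gez0_abs // (le_lt_trans (lerD h2 (lexx 1))).
have adjC (u v : vertex d) : adjacent u v = adjacent v u.
  by rewrite /adjacent; under eq_bigr do rewrite distrC.
have mem_s y : adjacent (val x) y -> [fset val x; y]%fset \in s.
  move=> /boxP[c ->]; apply/allpairsP; exists (val x, c); split=> //=.
  by rewrite mem_enum.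
case/existsP: (ee) => u /existsP[v].
move: (val u) (val v) => {}u {}v /andP[/eqP euv uv].
rewrite /= in mem_s.
move: xe mem_s; rewrite euv !inE => /orP[]/eqP-> mem_s; first exact: mem_s.
by rewrite fsetUC mem_s // adjC.
Qed.

Definition Vplus (d : nat) (L : region d) : set (vertex d) :=
  [set x | exists e : edge d, e \in rE L /\ x \in val e].

Definition Psi (d : nat) := vertex d -> bool.
Definition Omega (d : nat) := edge d -> bool.

Definition edge_in (d : nat) (psi : Psi d) (e : edge d) : bool :=
  [forall x : val e, psi (val x)].

Definition Theta (d : nat) : set (Psi d * Omega d) :=
  [set theta : Psi d * Omega d |
    forall e : edge d, theta.2 e -> edge_in theta.1 e].
Arguments Theta {d}.

Definition ThetaL (d : nat) (L : region d) (lambda : Psi d * Omega d)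
    : set (Psi d * Omega d) :=
  [set theta : Psi d * Omega d | [/\ theta \in Theta,
    (forall x, x \notin rV L -> theta.1 x = lambda.1 x) &
    (forall e, e \notin rE L -> theta.2 e = lambda.2 e)]].

Definition E_in (d : nat) (L : region d) (psi : Psi d) : {fset edge d} :=
  [fset e in rE L | edge_in psi e]%fset.

Definition open_adj (d : nat) (omega : Omega d) (x y : vertex d) : Prop :=
  exists e : edge d, val e = [fset x; y]%fset /\ omega e.

(* The connected components of the infinite graph (Z^d_psi, eta(omega)); an
   open vertex without open edges is a component of its own. *)
Definition components (d : nat) (theta : Psi d * Omega d)
    : set (set (vertex d)) :=
  [set C | exists x : vertex d, theta.1 x /\
     C = [set y | clos_refl_trans (vertex d) (open_adj theta.2) x y]].

Definition ncomp (d : nat) (theta : Psi d * Omega d) (L : region d) : nat :=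
  #|` fset_set [set C | components theta C /\ C `&` Vplus L !=set0] |.

Definition drc_weight (R : realType) (d : nat) (L : region d) (a p q : R)
    (theta : Psi d * Omega d) : R :=
  Num.sqrt (1 - p) ^+ #|` E_in L theta.1| * q ^+ ncomp theta L
  * (\prod_(x <- rV L) (a / (1 - a)) ^+ theta.1 x)
  * (\prod_(e <- E_in L theta.1) (p / (1 - p)) ^+ theta.2 e).

(* ThetaL L lambda is finite, so the finitely supported sums below are
   genuine sums. *)
Definition drc_Z (R : realType) (d : nat) (L : region d)
    (lambda : Psi d * Omega d) (a p q : R) : R :=
  \sum_(theta \in ThetaL L lambda) drc_weight L a p q theta.

Definition drc (R : realType) (d : nat) (L : region d)
    (lambda : Psi d * Omega d) (a p q : R) (theta : Psi d * Omega d) : R :=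
  if theta \in ThetaL L lambda
  then drc_weight L a p q theta / drc_Z L lambda a p q else 0.

Definition drc_marginal (R : realType) (d : nat) (L : region d)
    (lambda : Psi d * Omega d) (a p q : R) (s : {ffun rV L -> bool}) : R :=
  \sum_(theta \in [set theta : Psi d * Omega d |
                    forall x : rV L, theta.1 (val x) = s x])
     drc L lambda a p q theta.
Arguments drc_marginal {R d} L lambda a p q s.

(* Measures on Sigma = {0,1}^I, given by their point masses *)

Definition is_probability (R : realType) (T : finType) (mu : T -> R) : Prop :=
  (forall s, 0 <= mu s) /\ \sum_s mu s = 1.

Definition Pr (R : realType) (T : finType) (mu : T -> R) (A : {set T}) : R :=
  \sum_(s in A) mu s.

(* Equal to 0 when Pr mu B = 0, which never occurs for the events Sigma tau J
   under drc_marginal: all its point masses are positive. *)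
Definition condPr (R : realType) (T : finType) (mu : T -> R) (A B : {set T})
    : R :=
  Pr mu (A :&: B) / Pr mu B.

Definition config_le (I : finType) (s t : {ffun I -> bool}) : bool :=
  [forall i, s i ==> t i].

Definition increasing (I : finType) (A : {set {ffun I -> bool}}) : Prop :=
  forall s t, config_le s t -> s \in A -> t \in A.

Definition positively_associated (R : realType) (I : finType)
    (mu : {ffun I -> bool} -> R) : Prop :=
  forall A B : {set {ffun I -> bool}}, increasing A -> increasing B ->
    Pr mu A * Pr mu B <= Pr mu (A :&: B).

Definition Sigma (I : finType) (tau : {ffun I -> bool}) (J : {set I})
    : {set {ffun I -> bool}} :=
  [set s : {ffun I -> bool} | [forall (i | i \notin J), s i == tau i]].

Definition restr (I : finType) (J : {set I}) (s : {ffun I -> bool})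
    : {ffun {i : I | i \in J} -> bool} :=
  [ffun j => s (val j)].

Definition cond_on (R : realType) (I : finType) (mu : {ffun I -> bool} -> R)
    (tau : {ffun I -> bool}) (J : {set I})
    (s : {ffun {i : I | i \in J} -> bool}) : R :=
  condPr mu [set sigma | restr J sigma == s] (Sigma tau J).
Arguments cond_on {R I} mu tau J s.

Definition strongly_positively_associated (R : realType) (I : finType)
    (mu : {ffun I -> bool} -> R) : Prop :=
  forall (tau : {ffun I -> bool}) (J : {set I}),
    positively_associated (cond_on mu tau J).

Definition monotonic (R : realType) (I : finType)
    (mu : {ffun I -> bool} -> R) : Prop :=
  forall (i : I) (tau tau' : {ffun I -> bool}), config_le tau tau' ->
    condPr mu [set s : {ffun I -> bool} | s i] (Sigma tau [set i]%SET)
    <= condPr mu [set s : {ffun I -> bool} | s i] (Sigma tau' [set i]%SET).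

(* Main.v *)
(* Write K(A) for the number of classes of V^+ under connection by the open edges
   A in E together with those of lambda outside E, closed vertices being counted
   as singleton classes. Then k(theta, Lambda) = K(A) - #(closed vertices of V^+),
   so that up to a factor multiplicative over vertices the marginal weight of psi
   is F(E_psi), where
     F(D) = r^|D| sum_(A <= D) t^|A| q^K(A),   t = p / (1 - p).
   For q >= 1 the supermodularity of K and the four functions theorem of Ahlswede
   and Daykin make F log-supermodular, and for q <= 2 F is increasing in D, since
   r (1 + t / q) >= 1. As E_(psi /\ psi') is the intersection of E_psi and E_psi'
   while E_(psi \/ psi') contains their union, the marginal satisfies the FKG
   lattice condition, which yields strong positive association (by the four
   functions theorem again) and monotonicity. *)

Require Import Defs.
From Stdlib Require Import Relation_Operators.
From mathcomp Require Import all_boot all_order all_algebra finmap.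
From mathcomp Require Import all_classical reals.
From mathcomp Require Import ring lra zify.

Import Order.TTheory GRing.Theory Num.Theory.
Local Open Scope classical_set_scope.
Local Open Scope ring_scope.

(** * The four functions theorem of Ahlswede and Daykin *)

(** One-point case of the theorem. Only the mixed terms [x = a0 * b1] and [y = a1 * b0] need work:
    both are at most [P = c1 * d0], so [(P - x) * (P - y) >= 0], and [x * y <= P * (c0 * d1)] by
    multiplying the two diagonal hypotheses. Together these give [P * (x + y) <= P * (P + c0 * d1)].
    If [P = 0], the mixed terms vanish. *)
Lemma four_functions_bool (R : realDomainType) (a0 a1 b0 b1 c0 c1 d0 d1 : R) :
  0 <= a0 -> 0 <= a1 -> 0 <= b0 -> 0 <= b1 ->
  0 <= c0 -> 0 <= c1 -> 0 <= d0 -> 0 <= d1 ->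
  a0 * b0 <= c0 * d0 -> a0 * b1 <= c1 * d0 ->
  a1 * b0 <= c1 * d0 -> a1 * b1 <= c1 * d1 ->
  (a0 + a1) * (b0 + b1) <= (c0 + c1) * (d0 + d1).
Proof.
move=> a0p a1p b0p b1p c0p c1p d0p d1p h00 h01 h10 h11.
suff mixed : a0 * b1 + a1 * b0 <= c1 * d0 + c0 * d1.
  by rewrite !mulrDl !mulrDr; lra.
have [P0|Ppos] := eqVneq (c1 * d0) 0.
  by have := mulr_ge0 c0p d1p; rewrite P0 in h01 h10 *; lra.
rewrite -(@ler_pM2l _ (c1 * d0)); last by rewrite lt_def Ppos mulr_ge0.
have prod_le : (a0 * b0) * (a1 * b1) <= (c0 * d0) * (c1 * d1).
  by apply: ler_pM => //; apply: mulr_ge0.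
have : 0 <= (c1 * d0 - a0 * b1) * (c1 * d0 - a1 * b0).
  by apply: mulr_ge0; rewrite subr_ge0.
have -> : (c1 * d0 - a0 * b1) * (c1 * d0 - a1 * b0) =
  c1 * d0 * (c1 * d0) - c1 * d0 * (a0 * b1 + a1 * b0) + a0 * b0 * (a1 * b1).
  by ring.
have -> : c1 * d0 * (c1 * d0 + c0 * d1) =
  c1 * d0 * (c1 * d0) + c0 * d0 * (c1 * d1) by ring.
lra.
Qed.

(** Peels off one point, both in the induction for the four functions theorem and in the comparison
    of [rc_sum] on edge sets differing by one edge. *)
Lemma sum_subset_setU1 (R : nmodType) (T : finType) (x : T) (D : {set T})
    (f : {set T} -> R) : x \notin D ->
  \sum_(A : {set T} | A \subset x |: D) f A =
  \sum_(A : {set T} | A \subset D) (f A + f (x |: A)%SET).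
Proof.
move=> xD; rewrite big_split /= (bigID (fun A : {set T} => x \in A)) /= addrC.
congr (_ + _).
  apply: eq_bigl => A; apply/andP/idP => [[AxD xA]|AD].
    apply/fintype.subsetP => y yA; move/fintype.subsetP: AxD => /(_ y yA).
    by rewrite !inE => /orP[/eqP yx|//]; rewrite -yx yA in xA.
  split; first exact: fintype.subset_trans AD (finset.subsetUr _ _).
  by apply: contra xD; move/fintype.subsetP: AD; apply.
rewrite (reindex_onto (fun A => x |: A)%SET (fun A => A :\ x)%SET) /=; last first.
  by move=> A /andP[_ xA]; rewrite finset.setD1K.
apply: eq_bigl => A; rewrite setU11 andbT; apply/andP/idP.
  case=> AxD /eqP AE; apply/fintype.subsetP => y yA.
  move/fintype.subsetP: AxD => /(_ y); rewrite !inE yA orbT => /(_ isT).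
  by move: yA; rewrite -AE !inE => /andP[/negPf-> _].
move=> AD; split; first exact: finset.setUS.
by rewrite finset.setU1K //; apply: contra xD; move/fintype.subsetP: AD; apply.
Qed.

(** Induction on [D]: summing out a point [x] replaces each function [F] by
    [A |-> F A + F (x |: A)], and the one-point case restores the hypothesis over [D :\ x]. *)
Lemma four_functions_subset (R : realDomainType) (T : finType) (D : {set T})
    (f g h k : {set T} -> R) :
  (forall A, 0 <= f A) -> (forall A, 0 <= g A) ->
  (forall A, 0 <= h A) -> (forall A, 0 <= k A) ->
  (forall A B : {set T}, A \subset D -> B \subset D ->
     f A * g B <= h (A :|: B)%SET * k (A :&: B)%SET) ->
  (\sum_(A : {set T} | A \subset D) f A) * (\sum_(A : {set T} | A \subset D) g A) <=
  (\sum_(A : {set T} | A \subset D) h A) * (\sum_(A : {set T} | A \subset D) k A).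
Proof.
have [n] := ubnP #|D|; elim: n D f g h k => // n IH D f g h k Dn fp gp hp kp H.
have [->|[x xD]] := finset.set_0Vmem D.
  under eq_bigl do rewrite finset.subset0.
  under [X in _ * X <= _]eq_bigl do rewrite finset.subset0.
  under [X in _ <= X * _]eq_bigl do rewrite finset.subset0.
  under [X in _ <= _ * X]eq_bigl do rewrite finset.subset0.
  rewrite !big_pred1_eq.
  by have := H _ _ (finset.sub0set D) (finset.sub0set D);
    rewrite finset.setU0 finset.setI0.
rewrite -(finset.setD1K xD); have xD' : x \notin D :\ x by rewrite !inE eqxx.
rewrite !sum_subset_setU1 //; apply: IH.
- by rewrite (cardsD1 x D) xD in Dn.
- by move=> A; rewrite addr_ge0.
- by move=> A; rewrite addr_ge0.
- by move=> A; rewrite addr_ge0.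
- by move=> A; rewrite addr_ge0.
move=> A B AD BD.
have sub (C : {set T}) : C \subset D :\ x ->
    [/\ x \notin C, C \subset D & x |: C \subset D].
  rewrite finset.subsetD1 => /andP[CD ->]; split=> //.
  by rewrite finset.subUset finset.sub1set xD.
have [xA AD1 AD2] := sub _ AD; have [xB BD1 BD2] := sub _ BD.
(* If [x] belongs to exactly one of the two sets, it lies in their union but not in their
   intersection; hence both mixed products are bounded by the same [c1 * d0]. *)
have E1 : (A :|: (x |: B) = x |: (A :|: B))%SET by rewrite finset.setUCA.
have E2 : ((x |: A) :|: B = x |: (A :|: B))%SET by rewrite finset.setUA.
have E3 : ((x |: A) :|: (x |: B) = x |: (A :|: B))%SET by rewrite -finset.setUUr.
have E4 : (A :&: (x |: B) = A :&: B)%SET.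
  by apply/setP => y; rewrite !inE; case: eqP => [->|//]; rewrite (negPf xA).
have E5 : ((x |: A) :&: B = A :&: B)%SET.
  by apply/setP => y; rewrite !inE; case: eqP => [->|//]; rewrite (negPf xB) !andbF.
have E6 : ((x |: A) :&: (x |: B) = x |: (A :&: B))%SET by rewrite -finset.setUIr.
apply: four_functions_bool => //.
- exact: H.
- by rewrite -E1 -E4; apply: H.
- by rewrite -E2 -E5; apply: H.
- by rewrite -E3 -E6; apply: H.
Qed.

Lemma four_functions (R : realDomainType) (T : finType) (f g h k : {set T} -> R) :
  (forall A, 0 <= f A) -> (forall A, 0 <= g A) ->
  (forall A, 0 <= h A) -> (forall A, 0 <= k A) ->
  (forall A B, f A * g B <= h (A :|: B)%SET * k (A :&: B)%SET) ->
  (\sum_A f A) * (\sum_A g A) <= (\sum_A h A) * (\sum_A k A).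
Proof.
move=> fp gp hp kp H.
have sumT (F : {set T} -> R) :
    \sum_A F A = \sum_(A : {set T} | A \subset [set: T]%SET) F A.
  by apply: eq_bigl => A; rewrite finset.subsetT.
by rewrite !sumT; apply: four_functions_subset.
Qed.

Lemma sum_ffun_bool (R : nmodType) (I : finType) (F : {ffun I -> bool} -> R) :
  \sum_s F s = \sum_(A : {set I}) F [ffun i => i \in A].
Proof.
rewrite (reindex (fun A : {set I} => [ffun i => i \in A])) //=.
exists (fun s : {ffun I -> bool} => [set i | s i]%SET) => x _.
  by apply/setP => i; rewrite !inE ffunE.
by apply/ffunP => i; rewrite ffunE inE.
Qed.

(** * The FKG lattice condition and its consequences *)

Definition ffun_or {I : finType} (s t : {ffun I -> bool}) : {ffun I -> bool} :=
  [ffun i => s i || t i].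

Definition ffun_and {I : finType} (s t : {ffun I -> bool}) : {ffun I -> bool} :=
  [ffun i => s i && t i].

Definition lattice_condition {R : realType} {I : finType}
    (mu : {ffun I -> bool} -> R) : Prop :=
  forall s t, mu s * mu t <= mu (ffun_or s t) * mu (ffun_and s t).

(** Four functions theorem with [mu] restricted to [A], to [B] and to [A :&: B] as first three
    functions and [mu] itself, of total mass 1, as the fourth. If [s] is in [A] and [t] in [B],
    their join is in both, since both events are increasing. *)
Lemma lattice_positively_associated (R : realType) (I : finType)
    (mu : {ffun I -> bool} -> R) :
  is_probability mu -> lattice_condition mu -> positively_associated mu.
Proof.
move=> [mu0 mu1] mulat A B Ainc Binc.
have PrE (C : {set {ffun I -> bool}}) :
    Pr mu C = \sum_(D : {set I}) (mu [ffun i => i \in D] *+ ([ffun i => i \in D] \in C)).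
  by rewrite /Pr big_mkcond sum_ffun_bool; apply: eq_bigr => D _; rewrite mulrb.
have nonneg C D : 0 <= mu [ffun i => i \in D] *+ ([ffun i => i \in D] \in C).
  by rewrite mulrn_wge0.
rewrite -[leRHS]mulr1 -mu1 sum_ffun_bool !PrE; apply: four_functions => // D E.
have -> : [ffun i => i \in (D :|: E)%SET] =
    ffun_or [ffun i => i \in D] [ffun i => i \in E].
  by apply/ffunP => i; rewrite !ffunE inE.
have -> : [ffun i => i \in (D :&: E)%SET] =
    ffun_and [ffun i => i \in D] [ffun i => i \in E].
  by apply/ffunP => i; rewrite !ffunE inE.
move: [ffun i => i \in D] [ffun i => i \in E] => s t.
have [sA|_] := boolP (s \in A); last by rewrite mulr0n mul0r mulr_ge0 // mulrn_wge0.
have [tB|_] := boolP (t \in B); last by rewrite mulr0n mulr0 mulr_ge0 // mulrn_wge0.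
have sle : config_le s (ffun_or s t).
  by apply/forallP => i; rewrite ffunE; apply/implyP => ->.
have tle : config_le t (ffun_or s t).
  by apply/forallP => i; rewrite ffunE; apply/implyP => ->; rewrite orbT.
have stAB : ffun_or s t \in (A :&: B)%SET.
  by rewrite inE (Ainc _ _ sle sA) (Binc _ _ tle tB).
by rewrite stAB !mulr1n.
Qed.

(** Inverse of [restr J] on [Sigma tau J]; it presents the conditional measure as [mu] along
    [glue tau J], up to normalization. *)
Definition glue {I : finType} (tau : {ffun I -> bool}) (J : {set I})
    (s : {ffun {i : I | i \in J} -> bool}) : {ffun I -> bool} :=
  [ffun i => if insub i is Some j then s j else tau i].

Lemma glue_in (I : finType) (tau : {ffun I -> bool}) (J : {set I}) s
    (j : {i : I | i \in J}) : glue tau J s (val j) = s j.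
Proof. by rewrite ffunE valK. Qed.

Lemma glue_out (I : finType) (tau : {ffun I -> bool}) (J : {set I}) s i :
  i \notin J -> glue tau J s i = tau i.
Proof. by move=> iJ; rewrite ffunE insubN. Qed.

Lemma restr_glue (I : finType) (tau : {ffun I -> bool}) (J : {set I}) s :
  restr J (glue tau J s) = s.
Proof. by apply/ffunP => j; rewrite ffunE glue_in. Qed.

Lemma glue_Sigma (I : finType) (tau : {ffun I -> bool}) (J : {set I}) s :
  glue tau J s \in Sigma tau J.
Proof. by rewrite inE; apply/forall_inP => i iJ; rewrite glue_out. Qed.

Lemma glue_restr (I : finType) (tau : {ffun I -> bool}) (J : {set I}) s :
  s \in Sigma tau J -> glue tau J (restr J s) = s.
Proof.
rewrite inE => /forall_inP sJ; apply/ffunP => i.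
have [iJ|iJ] := boolP (i \in J); last by rewrite glue_out // (eqP (sJ i iJ)).
by rewrite (glue_in _ _ _ _ (exist _ i iJ)) ffunE.
Qed.

Lemma cond_onE (R : realType) (I : finType) (mu : {ffun I -> bool} -> R)
    (tau : {ffun I -> bool}) (J : {set I}) s :
  cond_on mu tau J s = mu (glue tau J s) / Pr mu (Sigma tau J).
Proof.
rewrite /cond_on /condPr; congr (_ / _).
rewrite {1}/Pr (big_pred1 (glue tau J s)) // => t.
rewrite !inE; apply/andP/eqP => [[/eqP <- tS]|->].
  by rewrite glue_restr // inE.
by rewrite restr_glue eqxx; have := glue_Sigma I tau J s; rewrite inE.
Qed.

Lemma Pr_Sigma (R : realType) (I : finType) (mu : {ffun I -> bool} -> R)
    (tau : {ffun I -> bool}) (J : {set I}) :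
  Pr mu (Sigma tau J) = \sum_s mu (glue tau J s).
Proof.
rewrite /Pr (reindex_onto (glue tau J) (restr J)) => [|s]; last exact: glue_restr.
by apply: eq_bigl => s; rewrite glue_Sigma restr_glue eqxx.
Qed.

(** The lattice condition survives conditioning: gluing commutes with joins and meets, and both
    sides carry the same normalization. Positivity of [mu] makes the conditioning event non-null. *)
Lemma lattice_strongly_positively_associated (R : realType) (I : finType)
    (mu : {ffun I -> bool} -> R) :
  (forall s, 0 < mu s) -> lattice_condition mu ->
  strongly_positively_associated mu.
Proof.
move=> mu_gt0 mulat tau J.
have S0 : 0 < Pr mu (Sigma tau J).
  rewrite Pr_Sigma (bigD1 (restr J tau)) //= ltr_wpDr ?sumr_ge0 // => s _.
  exact: ltW.
apply: lattice_positively_associated; first split.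
- by move=> s; rewrite cond_onE divr_ge0 // ltW.
- under eq_bigr do rewrite cond_onE.
  by rewrite -mulr_suml -Pr_Sigma divff // gt_eqF.
move=> s t; rewrite !cond_onE !mulrA ler_pM2r ?invr_gt0 //.
rewrite -![_ / _ * _]mulrAC ler_pM2r ?invr_gt0 //.
have -> : glue tau J (ffun_or s t) = ffun_or (glue tau J s) (glue tau J t).
  apply/ffunP => i; rewrite !ffunE; case: insub => [j|]; first by rewrite !ffunE.
  by rewrite orbb.
have -> : glue tau J (ffun_and s t) = ffun_and (glue tau J s) (glue tau J t).
  apply/ffunP => i; rewrite !ffunE; case: insub => [j|]; first by rewrite !ffunE.
  by rewrite andbb.
exact: mulat.
Qed.

Definition with_value {I : finType} (tau : {ffun I -> bool}) (i : I) (b : bool) :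
  {ffun I -> bool} := [ffun j => if j == i then b else tau j].

Lemma Sigma1 (I : finType) (tau : {ffun I -> bool}) (i : I) :
  Sigma tau [set i]%SET = [set with_value tau i true; with_value tau i false]%SET.
Proof.
apply/setP => s; rewrite !inE; apply/forall_inP/orP => [sE|H j].
  have sE' j : j != i -> s j = tau j by move=> ji; apply/eqP/sE; rewrite inE.
  case E: (s i); [left|right]; apply/eqP/ffunP => j; rewrite ffunE;
    by case: eqP => [->//|/eqP/sE'].
by rewrite inE => /negPf ji; case: H => /eqP ->; rewrite ffunE ji.
Qed.

Lemma condPr_Sigma1 (R : realType) (I : finType) (mu : {ffun I -> bool} -> R)
    (tau : {ffun I -> bool}) (i : I) :
  condPr mu [set s : {ffun I -> bool} | s i]%SET (Sigma tau [set i]%SET) =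
  mu (with_value tau i true) /
  (mu (with_value tau i true) + mu (with_value tau i false)).
Proof.
have neq : with_value tau i true != with_value tau i false.
  by apply/eqP => /ffunP/(_ i); rewrite !ffunE eqxx.
rewrite /condPr Sigma1; congr (_ / _).
  rewrite /Pr (big_pred1 (with_value tau i true)) // => s.
  rewrite !inE; apply/andP/eqP => [[si /orP[/eqP//|/eqP sE]]|->].
    by rewrite sE ffunE eqxx in si.
  by rewrite ffunE !eqxx.
by rewrite /Pr big_setU1 ?inE //= big_set1.
Qed.

(** For [tau <= tau'], the configurations [tau] with value 1 at [i] and [tau'] with value 0 at [i]
    have as join [tau'] with value 1 and as meet [tau] with value 0. The lattice condition for them
    compares the odds of a 1 at [i]. *)
Lemma lattice_monotonic (R : realType) (I : finType)
    (mu : {ffun I -> bool} -> R) :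
  (forall s, 0 < mu s) -> lattice_condition mu -> monotonic mu.
Proof.
move=> mu_gt0 mulat i tau tau' /forallP le.
have := mulat (with_value tau i true) (with_value tau' i false).
have -> : ffun_or (with_value tau i true) (with_value tau' i false) =
    with_value tau' i true.
  by apply/ffunP => j; rewrite !ffunE; case: eqP => // _; move: (le j); case: (tau j).
have -> : ffun_and (with_value tau i true) (with_value tau' i false) =
    with_value tau i false.
  apply/ffunP => j; rewrite !ffunE; case: eqP => // _; move: (le j).
  by case: (tau j) => //= ->.
rewrite !condPr_Sigma1 => H; rewrite ler_pdivrMr ?addr_gt0 //.
rewrite mulrAC ler_pdivlMr ?addr_gt0 // !mulrDr; lra.
Qed.

(** * Supermodular class counts and random-cluster sums *)

(* Adding e to A lowers K by [~~ c A e], which is nonincreasing in A. *)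
Lemma supermodular_of_rank_one (T : finType) (K : {set T} -> nat)
    (c : {set T} -> T -> bool) :
  (forall (A B : {set T}) e, A \subset B -> c A e -> c B e) ->
  (forall A e, (K (e |: A)%SET + ~~ c A e)%N = K A) ->
  forall A B, (K A + K B <= K (A :|: B)%SET + K (A :&: B)%SET)%N.
Proof.
move=> cmono Kadd A B.
(* The change of [K] on adding [S] is larger algebraically from the larger set [D] than from [C].
   Taking [C = A :&: B], [D = B] and [S = A] gives the claim. *)
suff H (S C D : {set T}) : C \subset D ->
    (K (C :|: S)%SET + K D <= K (D :|: S)%SET + K C)%N.
  have := H A _ _ (finset.subsetIr A B).
  by rewrite (finset.setUidPr (finset.subsetIl A B)) (finset.setUC B).
have [n] := ubnP #|S|; elim: n S => // n IH S Sn CD.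
have [->|[e eS]] := finset.set_0Vmem S; first by rewrite !finset.setU0 addnC.
have Sn' : (#|S :\ e| < n)%N by rewrite (cardsD1 e S) eS in Sn.
have := IH _ Sn' CD.
rewrite -(finset.setD1K eS) !(finset.setUCA _ [set e]%SET) finset.setD1K //.
set C' := (C :|: _)%SET; set D' := (D :|: _)%SET.
have := Kadd C' e; have := Kadd D' e.
have : c C' e -> c D' e by apply: cmono; rewrite /C' /D' finset.setSU.
by case: (c C' e) => [->//|_]; case: (c D' e); lia.
Qed.

Lemma rank_one_lower (T : finType) (K : {set T} -> nat)
    (c : {set T} -> T -> bool) :
  (forall A e, (K (e |: A)%SET + ~~ c A e)%N = K A) ->
  forall A e, (K A <= (K (e |: A)%SET).+1)%N.
Proof. by move=> Kadd A e; have := Kadd A e; case: (c A e); lia. Qed.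

(** For [t = p / (1 - p)] this is a random-cluster partition function on the edge set [D], up to a
    power of [1 - p]. *)
Definition rc_sum {R : realType} {T : finType} (K : {set T} -> nat) (t q : R)
    (D : {set T}) : R :=
  \sum_(A : {set T} | A \subset D) t ^+ #|A| * q ^+ K A.

Lemma rc_sum_gt0 (R : realType) (T : finType) (K : {set T} -> nat) (t q : R) D :
  0 <= t -> 0 < q -> 0 < rc_sum K t q D.
Proof.
move=> t0 q0; rewrite /rc_sum (bigD1 finset.set0) ?finset.sub0set //=.
rewrite cards0 expr0 mul1r ltr_wpDr ?exprn_gt0 //.
by apply: sumr_ge0 => A _; rewrite mulr_ge0 ?exprn_ge0 // ltW.
Qed.

(** Four functions theorem for the summand cut off to subsets of [B], of [C], of their union and of
    their intersection: the exponent of [t] is modular, and that of [q >= 1] is supermodular. *)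
Lemma rc_sum_log_supermodular (R : realType) (T : finType) (K : {set T} -> nat)
    (t q : R) (B C : {set T}) : 0 <= t -> 1 <= q ->
  (forall A B, (K A + K B <= K (A :|: B)%SET + K (A :&: B)%SET)%N) ->
  rc_sum K t q B * rc_sum K t q C <=
  rc_sum K t q (B :|: C)%SET * rc_sum K t q (B :&: C)%SET.
Proof.
move=> t0 q1 Ksup; have q0 : 0 <= q by lra.
rewrite /rc_sum !(big_mkcond (fun A : {set T} => A \subset _)).
have nonneg (A D : {set T}) :
    0 <= (if A \subset D then t ^+ #|A| * q ^+ K A else 0).
  by case: ifP => // _; rewrite mulr_ge0 ?exprn_ge0.
apply: four_functions => // A A'.
have [AB|_] := boolP (A \subset B); last by rewrite mul0r mulr_ge0.
have [AC|_] := boolP (A' \subset C); last by rewrite mulr0 mulr_ge0.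
rewrite finset.setUSS // finset.setISS // mulrACA [leRHS]mulrACA -!exprD.
by rewrite cardsUI ler_wpM2l ?exprn_ge0 // ler_weXn2l.
Qed.

(** Edges are added one at a time. Pairing [A] with [e |: A], where [K] drops by at most 1, shows
    that a new edge multiplies the weight by at least [r * (1 + t / q)]; this is at least 1 because
    [q <= 2]. *)
Lemma rc_sum_nondecreasing (R : realType) (T : finType) (K : {set T} -> nat)
    (p q : R) (D D' : {set T}) : 0 <= p < 1 -> 1 <= q <= 2 ->
  (forall A e, (K A <= (K (e |: A)%SET).+1)%N) -> D \subset D' ->
  Num.sqrt (1 - p) ^+ #|D| * rc_sum K (p / (1 - p)) q D <=
  Num.sqrt (1 - p) ^+ #|D'| * rc_sum K (p / (1 - p)) q D'.
Proof.
move=> /andP[p0 p1] /andP[q1 q2] Klow.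
have q0 : 0 < q by lra.
set r := Num.sqrt (1 - p); set t := p / (1 - p).
have r0 : 0 < r by rewrite sqrtr_gt0; lra.
have r2 : r * r = 1 - p by rewrite -expr2 sqr_sqrtr //; lra.
have t0 : 0 <= t by rewrite divr_ge0 //; lra.
have tr : t * (r * r) = 1 - r * r by rewrite r2 /t; field; lra.
(* After clearing denominators this is (1 - r) (1 - (q - 1) r) >= 0. *)
have key : 1 <= r * (1 + t / q).
  rewrite -(ler_pM2l (mulr_gt0 q0 r0)).
  have -> : q * r * (r * (1 + t / q)) = q * (r * r) + t * (r * r).
    by field; rewrite gt_eqF.
  have : 0 <= (1 - r) * (1 - (q - 1) * r) by apply: mulr_ge0; nra.
  rewrite tr; lra.
have step (B : {set T}) e : e \notin B ->
    rc_sum K t q B <= r * rc_sum K t q (e |: B)%SET.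
  move=> eB; rewrite /rc_sum sum_subset_setU1 // mulr_sumr.
  apply: ler_sum => A AB.
  have eA : e \notin A by apply: contra eB; move/fintype.subsetP: AB; apply.
  rewrite cardsU1 eA exprS.
  set w := t ^+ #|A|; have w0 : 0 <= w by rewrite exprn_ge0.
  have low : q ^+ K A / q <= q ^+ K (e |: A)%SET.
    by rewrite ler_pdivrMr // -exprSr ler_weXn2l.
  have x0 : 0 <= q ^+ K A by rewrite exprn_ge0 // ltW.
  have le1 := ler_wpM2r x0 key; rewrite mul1r in le1.
  have le2 := ler_wpM2l (ltW r0) (ler_wpM2l t0 low).
  have -> : r * (w * q ^+ K A + t * w * q ^+ K (e |: A)%SET) =
      w * (r * (q ^+ K A + t * q ^+ K (e |: A)%SET)) by ring.
  rewrite ler_wpM2l //; lra.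
have [n] := ubnP #|D' :\: D|; elim: n D => // n IH D Dn DD'.
have [E|[e]] := finset.set_0Vmem (D' :\: D)%SET.
  have -> // : D' = D.
  by apply/eqP; rewrite finset.eqEsubset DD' andbT -finset.setD_eq0 E.
rewrite !inE => /andP[eD eD'].
apply: le_trans (IH (e |: D)%SET _ _); last first.
- by rewrite finset.subUset finset.sub1set eD'.
- have eDD : e \in (D' :\: D)%SET by rewrite !inE eD.
  by rewrite finset.setUC -finset.setDDl; rewrite (cardsD1 e) eDD in Dn.
rewrite cardsU1 eD exprSr -mulrA; apply: ler_wpM2l; last exact: step.
by rewrite exprn_ge0 // ltW.
Qed.

(** * Counting the classes of a relation *)

Definition cls {T : Type} (e : T -> T -> Prop) (x : T) : set T :=
  [set y | clos_refl_trans T e x y].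

Definition nclasses {T : choiceType} (W : {fset T}) (e : T -> T -> Prop) : nat :=
  #|` [fset cls e x | x in W]%fset|.

Definition add_pair {T : Type} (e : T -> T -> Prop) (u v x y : T) : Prop :=
  e x y \/ (x = u /\ y = v) \/ (x = v /\ y = u).

Lemma clos_refl_trans_sym (T : Type) (e : T -> T -> Prop) :
  (forall x y, e x y -> e y x) ->
  forall x y, clos_refl_trans T e x y -> clos_refl_trans T e y x.
Proof.
move=> eC x y; elim=> [a b /eC|a|a b c _ ba _ cb].
- exact: rt_step.
- exact: rt_refl.
- exact: rt_trans cb ba.
Qed.

Lemma clos_refl_trans_mono (T : Type) (e e' : T -> T -> Prop) :
  (forall x y, e x y -> e' x y) ->
  forall x y, clos_refl_trans T e x y -> clos_refl_trans T e' x y.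
Proof.
move=> ee' x y; elim=> [a b /ee'|a|a b c _ ba _ cb].
- exact: rt_step.
- exact: rt_refl.
- exact: rt_trans ba cb.
Qed.

Lemma cls_eq (T : Type) (e : T -> T -> Prop) (x y : T) :
  (forall x y, e x y -> e y x) ->
  cls e x = cls e y <-> clos_refl_trans T e x y.
Proof.
move=> eC; split=> [E|xy].
  by have : cls e y y by [exact: rt_refl]; rewrite -E.
apply/seteqP; split=> z xz; apply: rt_trans xz => //.
exact: clos_refl_trans_sym xy.
Qed.

(** A path that uses the new pair starts and ends in the classes of [u] and [v]. *)
Lemma clos_refl_trans_add_pair (T : Type) (e : T -> T -> Prop) (u v x y : T) :
  (forall x y, e x y -> e y x) ->
  clos_refl_trans T (add_pair e u v) x y <->
  clos_refl_trans T e x y \/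
  (clos_refl_trans T e u x \/ clos_refl_trans T e v x) /\
  (clos_refl_trans T e u y \/ clos_refl_trans T e v y).
Proof.
move=> eC; have sym := @clos_refl_trans_sym T e eC.
have tr a b c := rt_trans T e a b c.
split.
  elim=> {x y} [x y [xy|[[-> ->]|[-> ->]]]|x|x y z _ IH1 _ IH2].
  - by left; apply: rt_step.
  - by right; split; [left|right]; apply: rt_refl.
  - by right; split; [right|left]; apply: rt_refl.
  - by left; apply: rt_refl.
  - case: IH1 => [xy|[hx hy]]; case: IH2 => [yz|[hy' hz]].
    + by left; apply: tr xy yz.
    + right; split=> //; case: hy' => h; [left|right]; exact: tr h (sym _ _ xy).
    + right; split=> //; case: hy => h; [left|right]; exact: tr h yz.
    + by right.
have sub a b : clos_refl_trans T e a b -> clos_refl_trans T (add_pair e u v) a b.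
  by apply: clos_refl_trans_mono => ? ?; left.
have uv : clos_refl_trans T (add_pair e u v) u v by apply: rt_step; right; left.
have vu : clos_refl_trans T (add_pair e u v) v u by apply: rt_step; right; right.
have toU a : clos_refl_trans T e u a \/ clos_refl_trans T e v a ->
    clos_refl_trans T (add_pair e u v) u a.
  by case=> /sub // va; apply: rt_trans uv va.
have fromU a : clos_refl_trans T e u a \/ clos_refl_trans T e v a ->
    clos_refl_trans T (add_pair e u v) a u.
  case=> /sym/sub // av; exact: rt_trans av vu.
by case=> [/sub//|[/fromU xu /toU]]; apply: rt_trans.
Qed.

(** The classes of [u] and [v] merge and all others are unchanged; as [u] and [v] lie in [W], the
    merger is seen by the count. *)
Lemma nclasses_add_pair (T : choiceType) (W : {fset T}) (e : T -> T -> Prop)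
    (u v : T) :
  (forall x y, e x y -> e y x) -> u \in W -> v \in W ->
  (nclasses W (add_pair e u v) + ~~ `[< clos_refl_trans T e u v >])%N =
  nclasses W e.
Proof.
move=> eC uW vW; have sym := @clos_refl_trans_sym T e eC.
have tr a b c := rt_trans T e a b c.
have cE x y := cls_eq T e x y eC.
have addE x y := clos_refl_trans_add_pair T e u v x y eC.
rewrite /nclasses; have [uv|nuv] := asboolP.
  rewrite addn0; congr #|` _|; apply: eq_imfset => //= x.
  apply/seteqP; split=> y; rewrite /cls /= addE; last by left.
  case=> // -[hx hy]; apply: (@tr _ u).
    by case: hx => h; apply: sym => //; apply: tr uv h.
  by case: hy => h //; apply: tr uv h.
have cls_far x : ~ clos_refl_trans T e u x -> ~ clos_refl_trans T e v x ->
    cls (add_pair e u v) x = cls e x.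
  move=> ux vx; apply/seteqP; split=> y; rewrite /cls /= addE; last by left.
  by case=> // -[[]].
pose cu := cls e u; pose cv := cls e v.
have cls_near x : clos_refl_trans T e u x \/ clos_refl_trans T e v x ->
    cls (add_pair e u v) x = cu `|` cv.
  move=> ux; apply/seteqP; split=> y; rewrite /cls /= addE; last by right.
  case=> [xy|[]//]; case: ux => h; [left|right]; exact: tr h xy.
set J := [fset cls e x | x in W]%fset.
set J' := [fset cls (add_pair e u v) x | x in W]%fset.
have cuJ : cu \in J by apply/imfsetP; exists u.
have cvJ : cv \in (J `\ cu)%fset.
  rewrite !inE; apply/andP; split; last by apply/imfsetP; exists v.
  by apply/eqP => /esym/cE.
have cuvJ' : cu `|` cv \in J'.
  by apply/imfsetP; exists u => //=; rewrite cls_near //; left; apply: rt_refl.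
(* Removing the merged class on one side and the two original classes on the other leaves the same
   family. *)
rewrite (cardfsD1 (cu `|` cv) J') cuvJ' (cardfsD1 cu J) cuJ.
rewrite (cardfsD1 cv (J `\ cu)%fset) cvJ /= addn1 !add1n.
congr (#|` _|.+2); apply/fsetP => C; rewrite !inE.
apply/andP/and3P => [[Ccuv /imfsetP[x /= xW CE]]|[Ccv Ccu /imfsetP[x /= xW CE]]].
  have ux : ~ clos_refl_trans T e u x.
    by move=> h; move: Ccuv; rewrite CE cls_near ?eqxx //; left.
  have vx : ~ clos_refl_trans T e v x.
    by move=> h; move: Ccuv; rewrite CE cls_near ?eqxx //; right.
  rewrite CE cls_far //; split; last by apply/imfsetP; exists x.
    by apply/eqP => /esym/cE.
  by apply/eqP => /esym/cE.
have ux : ~ clos_refl_trans T e u x.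
  by move=> /cE h; rewrite CE -h eqxx in Ccu.
have vx : ~ clos_refl_trans T e v x.
  by move=> /cE h; rewrite CE -h eqxx in Ccv.
split; last by apply/imfsetP; exists x => //; rewrite cls_far.
apply/eqP => CE'; apply: ux; apply: sym; rewrite -[_ x u]/(cls e x u) -CE CE'.
by left; apply: rt_refl.
Qed.

(** Turns the finitely supported sums over configurations of the infinite lattice into sums over a
    finite type. The alternative [F j = 0] serves the marginal, whose index set constrains a
    configuration on [V] only. *)
Lemma fsbig_reindex_fin (R : nmodType) (I : finType) (J : choiceType)
    (P : pred I) (Q : set J) (h : I -> J) (F : J -> R) :
  injective h -> (forall i, P i -> Q (h i)) ->
  (forall j, Q j -> (exists2 i, P i & h i = j) \/ F j = 0) ->
  \sum_(j \in Q) F j = \sum_(i | P i) F (h i).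
Proof.
move=> hinj hQ Qh; rewrite -(fsbig_widen (h @` [set i | P i]) Q) /=.
- rewrite fsbig_image; last by move=> i j _ _; apply: hinj.
  rewrite (fsbigE (enum P)) ?enum_uniq //.
  + rewrite big_enum_cond /=; apply: eq_bigl => i.
    by rewrite andb_idr // => Pi; rewrite inE.
  + by move=> i /=; rewrite mem_enum.
  + by move=> i /= Pi; rewrite mem_enum => /negP.
- by move=> _ [i Pi <-]; apply: hQ.
- by move=> j [/Qh[[i Pi hi] nj|//]]; case: nj; exists i.
Qed.

(** A point outside [P] has no related pair, so it is alone in its class, and such singletons are
    disjoint from the classes of points in [P]. *)
Lemma nclasses_isolated (T : choiceType) (W : {fset T}) (e : T -> T -> Prop)
    (P : pred T) :
  (forall x y, e x y -> P x /\ P y) ->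
  nclasses W e = (#|` [fset cls e x | x in [fset y in W | P y]]%fset| +
                    #|` [fset x in W | ~~ P x]%fset|)%N.
Proof.
move=> eP.
have closP x y : clos_refl_trans T e x y -> x = y \/ P x /\ P y.
  elim=> [a b /eP|a|a b c _ [->|[Pa Pb]] _ [<-|[Pb' Pc]]]; by [left|right].
have isol x : ~~ P x -> cls e x = [set x].
  move=> nPx; apply/seteqP; split=> y; last by move=> ->; apply: rt_refl.
  by move=> /closP[->//|[Px _]]; rewrite Px in nPx.
have inj : {in [fset x in W | ~~ P x]%fset &, injective (cls e)}.
  move=> x y; rewrite !inE => /andP[_ nPx] /andP[_ nPy] E.
  have : cls e x y by rewrite E; apply: rt_refl.
  by rewrite isol.
have <- : #|` [fset cls e x | x in [fset y in W | ~~ P y]]%fset| =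
    #|` [fset x in W | ~~ P x]%fset| by rewrite card_in_imfset.
rewrite -cardfsUI.
set A := imfset _ _ _; set B := imfset _ _ _.
have -> : (A `&` B)%fset = fset0.
  apply/fsetP => C; rewrite !inE; apply/negP => /andP[].
  move=> /imfsetP[x /=]; rewrite !inE => /andP[_ Px] ->.
  move=> /imfsetP[y /=]; rewrite !inE => /andP[_ nPy].
  rewrite (isol y) // => E; have : cls e x x by apply: rt_refl.
  by rewrite E => /= xy; rewrite xy (negPf nPy) in Px.
rewrite cardfs0 addn0; congr #|` _|; apply/fsetP => C; rewrite inE.
apply/imfsetP/orP => [[x /= xW ->]|[]/imfsetP[x /=]].
- have [Px|nPx] := boolP (P x); [left|right]; apply/imfsetP; exists x => //=.
    by rewrite !inE xW.
  by rewrite !inE xW.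
- by rewrite !inE => /andP[xW _] ->; exists x.
- by rewrite !inE => /andP[xW _] ->; exists x.
Qed.

(** * Finite description of the configurations with boundary condition [lambda] *)

Definition ext_psi {d} (L : region d) (lambda : Psi d * Omega d)
    (s : {ffun rV L -> bool}) : Psi d :=
  fun x => if insub x is Some j then s j else lambda.1 x.

Definition ext_omega {d} (L : region d) (lambda : Psi d * Omega d)
    (A : {set rE L}) : Omega d :=
  fun e => if insub e is Some f then f \in A else lambda.2 e.

(** On the pairs with [A] inside [open_edges L lambda s] this is a bijection onto
    [ThetaL L lambda]. *)
Definition ext {d} (L : region d) (lambda : Psi d * Omega d)
    (sA : {ffun rV L -> bool} * {set rE L}) : Psi d * Omega d :=
  (ext_psi L lambda sA.1, ext_omega L lambda sA.2).

Definition open_edges {d} (L : region d) (lambda : Psi d * Omega d)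
    (s : {ffun rV L -> bool}) : {set rE L} :=
  [set e : rE L | edge_in (ext_psi L lambda s) (val e)]%SET.

Lemma ext_psi_in d (L : region d) lambda s (x : rV L) :
  ext_psi L lambda s (val x) = s x.
Proof. by rewrite /ext_psi valK. Qed.

Lemma ext_psi_out d (L : region d) lambda s x :
  x \notin rV L -> ext_psi L lambda s x = lambda.1 x.
Proof. by move=> xL; rewrite /ext_psi insubN. Qed.

Lemma ext_omega_in d (L : region d) lambda A (e : rE L) :
  ext_omega L lambda A (val e) = (e \in A).
Proof. by rewrite /ext_omega valK. Qed.

Lemma ext_omega_out d (L : region d) lambda A e :
  e \notin rE L -> ext_omega L lambda A e = lambda.2 e.
Proof. by move=> eL; rewrite /ext_omega insubN. Qed.

Lemma edge_inP d (psi : Psi d) (e : edge d) :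
  reflect (forall x, x \in val e -> psi x) (edge_in psi e).
Proof.
apply: (iffP forallP) => [H x xe|H x]; first exact: (H [` xe]%fset).
exact: H (valP x).
Qed.

Lemma ext_inj d (L : region d) lambda : injective (ext L lambda).
Proof.
move=> [s A] [s' A'] E; congr pair.
  apply/ffunP => x; rewrite -!(ext_psi_in _ _ lambda).
  by rewrite -[ext_psi _ _ s]/(ext L lambda (s, A)).1 E.
apply/setP => e; rewrite -!(ext_omega_in _ _ lambda).
by rewrite -[ext_omega _ _ A]/(ext L lambda (s, A)).2 E.
Qed.

(** An edge outside [E] has no end in [V], so its ends keep the states of [lambda], which is itself
    compatible. *)
Lemma ext_Theta d (L : region d) lambda s (A : {set rE L}) :
  lambda \in Theta -> A \subset open_edges L lambda s ->
  ext L lambda (s, A) \in Theta.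
Proof.
rewrite !inE => lT /fintype.subsetP AE e /= eo; apply/edge_inP => x xe.
have [eL|eL] := boolP (e \in rE L).
  move: eo; rewrite -[e]/(val [` eL]%fset) ext_omega_in => /AE.
  by rewrite inE => /edge_inP; apply.
rewrite ext_omega_out // in eo; have /edge_inP/(_ x xe) := lT e eo.
rewrite ext_psi_out //; apply: contra eL => xL; rewrite rEP.
by apply/existsP; exists [` xL]%fset.
Qed.

Lemma ext_ThetaL d (L : region d) lambda s (A : {set rE L}) :
  lambda \in Theta -> A \subset open_edges L lambda s ->
  ThetaL L lambda (ext L lambda (s, A)).
Proof.
move=> lT AE; split; first exact: ext_Theta.
- by move=> x xL; rewrite /= ext_psi_out.
- by move=> e eL; rewrite /= ext_omega_out.
Qed.

Lemma ThetaL_ext d (L : region d) lambda theta : ThetaL L lambda theta ->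
  exists s, exists2 A : {set rE L}, A \subset open_edges L lambda s &
    ext L lambda (s, A) = theta.
Proof.
case: theta => psi omega [/set_mem T /= psiE omegaE].
have E1 : ext_psi L lambda [ffun x : rV L => psi (val x)] = psi.
  apply/funext => x; rewrite /ext_psi; case: insubP => [y _ <-|xL].
    by rewrite ffunE.
  by rewrite psiE.
exists [ffun x : rV L => psi (val x)].
exists [set e : rE L | omega (val e)]%SET.
  by apply/fintype.subsetP => e; rewrite !inE E1 => /T.
rewrite /ext /= E1; congr pair; apply/funext => e.
rewrite /ext_omega; case: insubP => [f _ <-|eL]; first by rewrite inE.
by rewrite omegaE.
Qed.

(** * Connected components as classes of [V^+] *)

Definition vplus {d} (L : region d) : {fset vertex d} :=
  (\bigcup_(e <- rE L) val e)%fset.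

Lemma vplusP d (L : region d) x : reflect (Vplus L x) (x \in vplus L).
Proof.
apply: (iffP (bigfcupP _ _ _ _)) => [[e]|[e [eL xe]]].
  by rewrite andbT => eL xe; exists e.
by exists e => //; rewrite andbT.
Qed.

Lemma edge_ends d (e : edge d) :
  exists uv : vertex d * vertex d, val e = [fset uv.1; uv.2]%fset.
Proof.
by have /existsP[x /existsP[y /andP[/eqP E _]]] := valP e; exists (val x, val y).
Qed.

Lemma open_adj_sym d (omega : Omega d) x y :
  open_adj omega x y -> open_adj omega y x.
Proof. by move=> [e [E oe]]; exists e; rewrite fsetUC. Qed.

Lemma open_adj_psi d (theta : Psi d * Omega d) x y : theta \in Theta ->
  open_adj theta.2 x y -> theta.1 x /\ theta.1 y.
Proof.
rewrite inE => T [e [E /T/edge_inP eo]].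
by split; apply: eo; rewrite E !inE eqxx ?orbT.
Qed.

(** The [K(A)] of the overview. The vertex configuration does not enter, so a single function serves
    for all [s] in the lattice condition. *)
Definition rc_classes {d} (L : region d) (lambda : Psi d * Omega d)
    (A : {set rE L}) : nat :=
  nclasses (vplus L) (open_adj (ext_omega L lambda A)).

Definition nclosed {d} (L : region d) (lambda : Psi d * Omega d)
    (s : {ffun rV L -> bool}) : nat :=
  #|` [fset x in vplus L | ~~ ext_psi L lambda s x]%fset|.

Lemma rc_classesE d (L : region d) lambda s (A : {set rE L}) :
  lambda \in Theta -> A \subset open_edges L lambda s ->
  rc_classes L lambda A = (ncomp (ext L lambda (s, A)) L + nclosed L lambda s)%N.
Proof.
move=> lT AE; have T := ext_Theta _ _ _ _ _ lT AE.
set theta := ext L lambda (s, A).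
have adjP x y : open_adj theta.2 x y -> theta.1 x /\ theta.1 y.
  exact: open_adj_psi.
rewrite /rc_classes (nclasses_isolated _ _ _ theta.1) //; congr (_ + _)%N.
have symt := @clos_refl_trans_sym _ _ (@open_adj_sym d theta.2).
have clE x y := cls_eq _ (open_adj theta.2) x y (@open_adj_sym d theta.2).
rewrite /ncomp -[imfset _ _ _]set_fsetK; congr #|` fset_set _|.
apply/seteqP; split=> C /=.
  move=> /imfsetP[x /=]; rewrite !inE => /andP[/vplusP xV px] ->.
  by split; [exists x|exists x; split=> //; apply: rt_refl].
(* The given representative [x] may lie outside [V^+]; it is replaced by the point [y] of [V^+] in
   the same component, which is open because open edges join open vertices. *)
move=> [[x [px CE]] [y [Cy /vplusP yV]]].
apply/imfsetP; exists y => /=.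
  rewrite !inE yV /=; move: Cy; rewrite CE /= => xy.
  have : theta.1 x -> theta.1 y; last exact.
  by elim: xy => // [a b /adjP[]|a b c _ ab _ bc /ab/bc].
rewrite CE; apply/clE; by move: Cy; rewrite CE.
Qed.

Lemma fset2_eq (T : choiceType) (x y u v : T) :
  [fset x; y]%fset = [fset u; v]%fset -> (x = u /\ y = v) \/ (x = v /\ y = u).
Proof.
move=> E.
have memE z : (z == x) || (z == y) = (z == u) || (z == v).
  by have /fsetP/(_ z) := E; rewrite !inE.
have := memE x; rewrite eqxx => /esym/orP[]/eqP xE; have := memE y;
  rewrite eqxx orbT => /esym/orP[]/eqP yE; try by [left|right].
- by have := memE v; rewrite xE yE eqxx orbT orbb => /eqP ->; left.
- by have := memE u; rewrite xE yE eqxx orbb => /eqP ->; left.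
Qed.

Lemma open_adj_setU1 d (L : region d) lambda (A : {set rE L}) (e : rE L) u v :
  val (val e) = [fset u; v]%fset ->
  open_adj (ext_omega L lambda (e |: A)%SET) =
  add_pair (open_adj (ext_omega L lambda A)) u v.
Proof.
move=> ee; have omegaE f : ext_omega L lambda (e |: A)%SET f =
    (f == val e) || ext_omega L lambda A f.
  have [fL|fL] := boolP (f \in rE L).
    by rewrite -[f]/(val [` fL]%fset) !ext_omega_in !inE.
  rewrite !ext_omega_out //; case: eqP => // fe.
  by rewrite fe (valP e) in fL.
apply/funext => x; apply/funext => y; apply/propext; split.
  move=> [f [fxy]]; rewrite omegaE => /orP[/eqP fe|fo]; last by left; exists f.
  by right; apply: fset2_eq; rewrite -fxy fe.
case=> [[f [fxy fo]]|H]; first by exists f; rewrite omegaE fo orbT.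
exists (val e); rewrite omegaE eqxx ee; split=> //.
by case: H => [[-> ->]//|[-> ->]]; rewrite fsetUC.
Qed.

(** [c A e] says that [A] and the boundary edges already connect the ends of [e], which is monotone
    in [A]. Both ends lie in [V^+], so opening [e] loses one class exactly when they were not
    connected. *)
Lemma rc_classes_rank_one d (L : region d) (lambda : Psi d * Omega d) :
  exists c : {set rE L} -> rE L -> bool,
  (forall (A B : {set rE L}) e, A \subset B -> c A e -> c B e) /\
  (forall A e, (rc_classes L lambda (e |: A)%SET + ~~ c A e)%N =
               rc_classes L lambda A).
Proof.
have [ends endsP] := choice (@edge_ends d).
exists (fun A e => `[< clos_refl_trans _ (open_adj (ext_omega L lambda A))
                        (ends (val e)).1 (ends (val e)).2 >]); split.
  move=> A B e /fintype.subsetP AB /asboolP H; apply/asboolP.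
  apply: clos_refl_trans_mono H => x y [f [fxy fo]]; exists f; split=> //; move: fo.
  by rewrite /ext_omega; case: insubP => // g _ _; apply: AB.
move=> A e; rewrite /rc_classes (open_adj_setU1 _ _ _ _ _ _ _ (endsP (val e))).
have inV x : x \in val (val e) -> x \in vplus L.
  by move=> xe; apply/vplusP; exists (val e); split=> //; apply: valP.
apply: nclasses_add_pair; first exact: open_adj_sym.
  by apply: inV; rewrite endsP !inE eqxx.
by apply: inV; rewrite endsP !inE eqxx orbT.
Qed.

(** * Behaviour under joins and meets, and the marginal weights *)

Lemma card_fset_sum (T : choiceType) (X : {fset T}) (P : pred T) :
  #|` [fset x in X | P x]%fset| = (\sum_(x <- X) P x)%N.
Proof.
rewrite -sum1_size big_fset /= big_mkcond.
by apply: eq_bigr => x _; case: (P x). Qed.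

Lemma ext_psi_or d (L : region d) lambda s t x :
  ext_psi L lambda (ffun_or s t) x = ext_psi L lambda s x || ext_psi L lambda t x.
Proof. by rewrite /ext_psi; case: insub => [y|]; rewrite ?ffunE ?orbb. Qed.

Lemma ext_psi_and d (L : region d) lambda s t x :
  ext_psi L lambda (ffun_and s t) x = ext_psi L lambda s x && ext_psi L lambda t x.
Proof. by rewrite /ext_psi; case: insub => [y|]; rewrite ?ffunE ?andbb. Qed.

Lemma nclosed_modular d (L : region d) lambda s t :
  (nclosed L lambda (ffun_or s t) + nclosed L lambda (ffun_and s t) =
   nclosed L lambda s + nclosed L lambda t)%N.
Proof.
rewrite /nclosed !card_fset_sum -!big_split /=; apply: eq_bigr => x _.
rewrite ext_psi_or ext_psi_and.
by case: (ext_psi L lambda s x); case: (ext_psi L lambda t x).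
Qed.

Lemma open_edges_and d (L : region d) lambda s t :
  open_edges L lambda (ffun_and s t) =
  (open_edges L lambda s :&: open_edges L lambda t)%SET.
Proof.
apply/setP => e; rewrite !inE; apply/edge_inP/andP => [H|[/edge_inP H1 /edge_inP H2]].
  by split; apply/edge_inP => x /H; rewrite ext_psi_and => /andP[].
by move=> x xe; rewrite ext_psi_and H1 // H2.
Qed.

(** The inclusion can be strict: one end of an edge may be open only in [s] and the other only in
    [t]. This is why monotonicity of the edge sum is needed besides log-supermodularity. *)
Lemma open_edges_or d (L : region d) lambda s t :
  open_edges L lambda s :|: open_edges L lambda t
    \subset open_edges L lambda (ffun_or s t).
Proof.
apply/fintype.subsetP => e; rewrite !inE => /orP[]/edge_inP H; apply/edge_inP => x /H;
  by rewrite ext_psi_or => ->; rewrite ?orbT.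
Qed.

(** The denominator removes the closed vertices counted by [rc_classes]. All exponents are modular,
    so this factor gives equality in the lattice condition. *)
Definition vertex_weight {R : realType} {d} (L : region d)
    (lambda : Psi d * Omega d) (a q : R) (s : {ffun rV L -> bool}) : R :=
  (\prod_x (a / (1 - a)) ^+ s x) / q ^+ nclosed L lambda s.

Lemma vertex_weight_gt0 (R : realType) d (L : region d) lambda (a q : R) s :
  0 < a < 1 -> 0 < q -> 0 < vertex_weight L lambda a q s.
Proof.
move=> /andP[a0 a1] q0; rewrite divr_gt0 ?exprn_gt0 // prodr_gt0 // => x _.
by rewrite exprn_gt0 // divr_gt0 // subr_gt0.
Qed.

Lemma vertex_weight_modular (R : realType) d (L : region d) lambda (a q : R) s t :
  vertex_weight L lambda a q (ffun_or s t) *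
  vertex_weight L lambda a q (ffun_and s t) =
  vertex_weight L lambda a q s * vertex_weight L lambda a q t.
Proof.
rewrite /vertex_weight !mulf_div -!exprD nclosed_modular -!big_split /=.
congr (_ / _); apply: eq_bigr => x _; rewrite !ffunE.
by case: (s x); case: (t x); rewrite //= mulrC.
Qed.

Lemma drc_weight_ext (R : realType) d (L : region d) lambda (a p q : R) s
    (A : {set rE L}) :
  lambda \in Theta -> 0 < q -> A \subset open_edges L lambda s ->
  drc_weight L a p q (ext L lambda (s, A)) =
  vertex_weight L lambda a q s *
  (Num.sqrt (1 - p) ^+ #|open_edges L lambda s| *
   ((p / (1 - p)) ^+ #|A| * q ^+ rc_classes L lambda A)).
Proof.
move=> lT q0 AE; rewrite /drc_weight (rc_classesE _ _ _ s) //.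
set k := ncomp _ _.
have -> : #|` E_in L (ext L lambda (s, A)).1| = #|open_edges L lambda s|.
  rewrite -sum1_size /E_in big_fset /= big_seq_fsetE /= -sum1_card.
  by apply: eq_bigl => e; rewrite inE.
have -> : \prod_(e <- E_in L (ext L lambda (s, A)).1)
    (p / (1 - p)) ^+ (ext L lambda (s, A)).2 e = (p / (1 - p)) ^+ #|A|.
  rewrite /E_in big_fset /= big_seq_fsetE /= -prodr_const.
  rewrite big_mkcond [RHS]big_mkcond; apply: eq_bigr => e _ /=.
  rewrite ext_omega_in; have [eA|_] := boolP (e \in A); last by case: ifP.
  by have := fintype.subsetP AE e eA; rewrite inE => ->.
rewrite big_seq_fsetE /= /vertex_weight.
under eq_bigr do rewrite ext_psi_in.
(* Here [z] is the power of [q] due to closed vertices; it cancels the denominator of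
   [vertex_weight]. *)
have alg (u v w y z : R) : z != 0 -> u * v * w * y = w / z * (u * (y * (v * z))).
  by move=> z0; field.
by rewrite exprD; apply: alg; rewrite gt_eqF // exprn_gt0.
Qed.

(** The unnormalized marginal; its second factor is the [F(E_psi)] of the overview. *)
Definition mass {R : realType} {d} (L : region d) (lambda : Psi d * Omega d)
    (a p q : R) (s : {ffun rV L -> bool}) : R :=
  vertex_weight L lambda a q s *
  (Num.sqrt (1 - p) ^+ #|open_edges L lambda s| *
   rc_sum (rc_classes L lambda) (p / (1 - p)) q (open_edges L lambda s)).

Lemma massE (R : realType) d (L : region d) lambda (a p q : R) s :
  lambda \in Theta -> 0 < q ->
  \sum_(A : {set rE L} | A \subset open_edges L lambda s)
    drc_weight L a p q (ext L lambda (s, A)) = mass L lambda a p q s.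
Proof.
move=> lT q0; rewrite /mass /rc_sum !mulr_sumr; apply: eq_bigr => A AE.
exact: drc_weight_ext.
Qed.

Lemma drc_ZE (R : realType) d (L : region d) lambda (a p q : R) :
  lambda \in Theta -> 0 < q ->
  drc_Z L lambda a p q = \sum_s mass L lambda a p q s.
Proof.
move=> lT q0; rewrite /drc_Z (fsbig_reindex_fin _ _ _
  (fun sA : {ffun rV L -> bool} * {set rE L} =>
    sA.2 \subset open_edges L lambda sA.1) _ (ext L lambda)).
- under [RHS]eq_bigr do rewrite -massE //.
  by rewrite pair_big_dep /=; apply: eq_bigr => -[].
- exact: ext_inj.
- by move=> [s A]; apply: ext_ThetaL.
- by move=> theta /ThetaL_ext[s [A AE E]]; left; exists (s, A).
Qed.

Lemma drc_marginalE (R : realType) d (L : region d) lambda (a p q : R) s :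
  lambda \in Theta -> 0 < q ->
  drc_marginal L lambda a p q s = mass L lambda a p q s / drc_Z L lambda a p q.
Proof.
move=> lT q0; rewrite /drc_marginal (fsbig_reindex_fin _ _ _
  (fun A : {set rE L} => A \subset open_edges L lambda s) _
  (fun A => ext L lambda (s, A))).
- rewrite -massE // mulr_suml; apply: eq_bigr => A AE.
  by rewrite /drc mem_set //; apply: ext_ThetaL.
- by move=> A A' /ext_inj[].
- by move=> A _ x; rewrite /= ext_psi_in.
(* A configuration agreeing with [s] on [V] either violates the boundary condition and has density
   0, or is an extension of [s]. *)
move=> theta thetas; rewrite /drc; case: ifPn => [/set_mem|_]; last by right.
move=> /ThetaL_ext[s' [A AE E]]; left.
suff Es : s' = s by exists A; rewrite -?Es.
by apply/ffunP => x; rewrite -thetas -E /= ext_psi_in.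
Qed.

Lemma mass_gt0 (R : realType) d (L : region d) lambda (a p q : R) s :
  0 < a < 1 -> 0 <= p < 1 -> 0 < q -> 0 < mass L lambda a p q s.
Proof.
move=> ha /andP[p0 p1] q0; rewrite mulr_gt0 ?vertex_weight_gt0 // mulr_gt0 //.
  by rewrite exprn_gt0 // sqrtr_gt0 subr_gt0.
by rewrite rc_sum_gt0 // divr_ge0 // subr_ge0 ltW.
Qed.

(** * The lattice condition for the marginal and the conclusion *)

Lemma mass_lattice (R : realType) d (L : region d) lambda (a p q : R) :
  0 < a < 1 -> 0 <= p < 1 -> 1 <= q <= 2 ->
  lattice_condition (mass L lambda a p q).
Proof.
move=> ha hp hq s t; have /andP[p0 p1] := hp; have /andP[q1 q2] := hq.
have q0 : 0 < q by lra.
have r0 : 0 <= Num.sqrt (1 - p) by exact: sqrtr_ge0.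
have t0 : 0 <= p / (1 - p) by rewrite divr_ge0 //; lra.
have [c [cmono cadd]] := rc_classes_rank_one d L lambda.
have Ksup := supermodular_of_rank_one _ _ _ cmono cadd.
have Klow := rank_one_lower _ _ _ cadd.
rewrite /mass mulrACA [leRHS]mulrACA vertex_weight_modular ler_wpM2l //.
  by rewrite mulr_ge0 // ltW // vertex_weight_gt0.
set B := open_edges L lambda s; set C := open_edges L lambda t.
set Z := rc_sum (rc_classes L lambda) (p / (1 - p)) q.
have Z0 D : 0 <= Z D by rewrite ltW // rc_sum_gt0.
(* The middle term replaces the open edges of the join by the union [B :|: C]. Log-supermodularity
   bounds it from below, the powers of [r] agreeing because cardinality is modular; monotonicity in
   the edge set bounds it from above. *)
apply: (@le_trans _ _
  (Num.sqrt (1 - p) ^+ #|B :|: C|%SET * Z (B :|: C)%SET *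
   (Num.sqrt (1 - p) ^+ #|B :&: C|%SET * Z (B :&: C)%SET))).
  rewrite mulrACA [leRHS]mulrACA -!exprD cardsUI ler_wpM2l ?exprn_ge0 //.
  exact: rc_sum_log_supermodular.
rewrite open_edges_and ler_wpM2r //; first by rewrite mulr_ge0 ?exprn_ge0.
by apply: rc_sum_nondecreasing => //; apply: open_edges_or.
Qed.

Theorem theorem5p3 (R : realType) (d : nat) (hd : (2 <= d)%N) (L : region d)
    (lambda : Psi d * Omega d) (hlambda : lambda \in Theta)
    (a p q : R) (ha : 0 < a < 1) (hp : 0 <= p < 1) (hq : 1 <= q <= 2) :
  [/\ is_probability (drc_marginal L lambda a p q),
      strongly_positively_associated (drc_marginal L lambda a p q) &
      monotonic (drc_marginal L lambda a p q)].
Proof.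
have q0 : 0 < q by case/andP: hq => q1 _; lra.
have m0 s : 0 < mass L lambda a p q s by apply: mass_gt0.
have Z0 : 0 < drc_Z L lambda a p q.
  rewrite drc_ZE // (bigD1 [ffun=> false]) //= ltr_wpDr ?sumr_ge0 // => s _.
  exact: ltW.
have mu0 s : 0 < drc_marginal L lambda a p q s.
  by rewrite drc_marginalE // divr_gt0.
have mulat : lattice_condition (drc_marginal L lambda a p q).
  move=> s t; rewrite !drc_marginalE // !mulf_div ler_pM2r ?invr_gt0 ?mulr_gt0 //.
  exact: mass_lattice.
split; first split.
- by move=> s; apply: ltW.
- under eq_bigr do rewrite drc_marginalE //.
  by rewrite -mulr_suml -drc_ZE // divff // gt_eqF.
- exact: lattice_strongly_positively_associated.
- exact: lattice_monotonic.
Qed.
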